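(* Let $\theta\in[0,1[$ be irrational and let $M\ge 1$ be an integer with $0<\theta<1/M$. Then there exist functions $p_k\in C^\infty(\mathbb{R}/\mathbb{Z})$, $k=-M,\ldots,M$, such that $p_k\neq 0$ (i.e. $p_k$ is not identically zero) for every $k\in\{0,1,\ldots,M\}$ and such that the following equations hold for all $x$: $$p_k(x)=\overline{p_{-k}(x+k\theta)},\qquad k=-M,\ldots,M,$$ $$p_k(x)=\sum_{m,a=-M}^{M}p_m(x+a\theta)\,p_a(x)\,\delta_{m+a,k},\qquad k=-M,\ldots,M,$$ $$0=\sum_{m,a=-M}^{M}p_m(x+a\theta)\,p_a(x)\,\delta_{m+a,k},\qquad k<-M\ \text{ and }\ k>M.$$ (These equations say exactly that $p=\sum_{n=-M}^{M}U^np_n(V)$ is a projection of order $M$ in the noncommutative 2-torus algebra $\mathcal{A}_\theta$.)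
   Context: $C^\infty(\mathbb{R}/\mathbb{Z})$ denotes smooth complex-valued functions on $\mathbb{R}$ of period $1$; $\delta_{i,j}$ is the Kronecker delta. For irrational $\theta\in[0,1[$, $A_\theta$ is the universal $C^*$-algebra generated by two unitaries $U,V$ with $VU=e^{2\pi i\theta}UV$, and $\mathcal{A}_\theta\subset A_\theta$ is the dense $*$-subalgebra of elements $\sum_{(m,n)\in\mathbb{Z}^2}a_{m,n}U^mV^n$ with $\{a_{m,n}\}$ a Schwartz sequence on $\mathbb{Z}^2$. For $f(x)=\sum_nf_ne^{2\pi inx}$ in $C^\infty(\mathbb{R}/\mathbb{Z})$, $f(V)=\sum_nf_nV^n$. A projection is a selfadjoint idempotent; it is of order $M$ if it has the form $\sum_{n=-M}^{M}U^np_n(V)$ with $p_n\in C^\infty(\mathbb{R}/\mathbb{Z})$ and $p_M\neq0$. *)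

(* Defs.v *)
(* Classical real numbers of Stdlib, complex numbers of Coquelicot. *)
From Stdlib Require Import Reals ZArith.
From Coquelicot Require Import Coquelicot.
Open Scope R_scope.

Definition irrational (t : R) : Prop :=
  ~ exists a b : Z, b <> 0%Z /\ t = IZR a / IZR b.

Definition smooth (f : R -> C) : Prop :=
  forall (n : nat) (x : R),
    ex_derive_n (fun t : R => Re (f t)) n x /\
    ex_derive_n (fun t : R => Im (f t)) n x.

(* Elements of C^oo(R/Z), seen as functions on R. *)
Definition smooth_periodic (f : R -> C) : Prop :=
  smooth f /\ (forall x : R, f (x + 1) = f x).

(* Kronecker symbol, complex-valued. *)
Definition delta (i j : Z) : C := if Z.eq_dec i j then RtoC 1 else RtoC 0.

(* F(-M) + ... + F(M): [sum_n a n] has the n + 1 terms a 0, ..., a n, so the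
   upper bound 2 * M gives all 2 M + 1 terms. *)
Definition sum_sym (M : nat) (F : Z -> C) : C :=
  sum_n (fun i : nat => F (Z.of_nat i - Z.of_nat M)%Z) (2 * M).

(* sum_{m,a=-M}^{M} p_m(x + a theta) p_a(x) delta_{m+a,k}, the
   coefficient of U^k in the square of sum_{n=-M}^{M} U^n p_n(V), because
   f(V) U^a = U^a f(. + a theta)(V) when V U = exp(2 pi i theta) U V. *)
Definition square_coef (theta : R) (M : nat) (p : Z -> R -> C) (k : Z)
    (x : R) : C :=
  sum_sym M (fun m : Z => sum_sym M (fun a : Z =>
    Cmult (Cmult (p m (x + IZR a * theta)) (p a x)) (delta (m + a) k))).

(* Main.v *)
(* Let phi be a smooth function on R, supported in an interval of length L <= 1
   and normalised by sum_j phi(x + j theta)^2 = 1.  Then the vectors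
   v_x = (phi(x + j theta))_j, x in R / theta Z, are orthonormal in the l^2
   spaces of the orbits of the rotation by theta: two lifts of the same point of
   R/Z differ by an integer, so L <= 1 makes their supports disjoint.  The
   projection onto their span has the coefficients
   p_k(x) = sum_{n in Z} phi(x + n + k theta) phi(x + n), a sum with the single
   term phi(t + k theta) phi(t), t = frac x, when the support is [0, L].  They
   vanish for |k| > M and not for |k| <= M when M theta < L <= (M + 1) theta. *)
Require Import Defs.
From Stdlib Require Import Reals ZArith Lra Lia.
From Coquelicot Require Import Coquelicot.
Open Scope R_scope.

(** * Smooth real functions and their closure properties *)

(** Derivatives are carried as witnesses, so closure under sums, products and composition follows by
    induction from the first-order rules alone. *)
Fixpoint Cn (n : nat) (f : R -> R) : Prop :=
  match n with
  | O => True
  | S m => exists f' : R -> R, (forall x, is_derive f x (f' x)) /\ Cn m f'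
  end.

Definition Cinf (f : R -> R) : Prop := forall n, Cn n f.

Lemma Cn_pred n f : Cn (S n) f -> Cn n f.
Proof.
revert f; induction n as [|n IH]; intros f [f' [Hd Hf']].
- exact I.
- exists f'; split; [exact Hd | exact (IH f' Hf')].
Qed.

Lemma Cn_ext n f g : (forall x, f x = g x) -> Cn n f -> Cn n g.
Proof.
destruct n as [|n]; intros Hfg Hf; [exact I|].
destruct Hf as [f' [Hd Hf']]; exists f'; split; [|exact Hf'].
intros x; apply (is_derive_ext f); auto.
Qed.

Lemma Cn_ex_derive_n n f : Cn n f -> forall x, ex_derive_n f n x.
Proof.
revert f; induction n as [|n IH]; intros f Hf x; [exact I|].
destruct Hf as [f' [Hd Hf']].
destruct n as [|n]; [exists (f' x); apply Hd|].
apply (ex_derive_ext (Derive_n f' n)); [|exact (IH f' Hf' x)].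
intros t; rewrite (Derive_n_ext f' (Derive_n f 1)).
- rewrite Derive_n_comp; f_equal; lia.
- intros s; symmetry; apply is_derive_unique, Hd.
Qed.

Lemma Cn_const n c : Cn n (fun _ => c).
Proof.
revert c; induction n as [|n IH]; intros c; [exact I|].
exists (fun _ => 0); split; [|apply IH].
intros x; apply (is_derive_const c x).
Qed.

Lemma Cn_plus n f g : Cn n f -> Cn n g -> Cn n (fun x => f x + g x).
Proof.
revert f g; induction n as [|n IH]; intros f g Hf Hg; [exact I|].
destruct Hf as [f' [Hdf Hf']]; destruct Hg as [g' [Hdg Hg']].
exists (fun x => f' x + g' x); split; [|apply IH; assumption].
intros x; apply (is_derive_plus f g x); auto.
Qed.

Lemma Cn_mult n f g : Cn n f -> Cn n g -> Cn n (fun x => f x * g x).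
Proof.
revert f g; induction n as [|n IH]; intros f g Hf Hg; [exact I|].
pose proof (Cn_pred _ _ Hf) as Hf0; pose proof (Cn_pred _ _ Hg) as Hg0.
destruct Hf as [f' [Hdf Hf']]; destruct Hg as [g' [Hdg Hg']].
exists (fun x => f' x * g x + f x * g' x); split.
- intros x; apply (is_derive_mult f g x); auto.
  intros a b; apply Rmult_comm.
- apply Cn_plus; apply IH; assumption.
Qed.

Lemma Cn_affine n f s b : Cn n f -> Cn n (fun x => f (s * x + b)).
Proof.
revert f; induction n as [|n IH]; intros f Hf; [exact I|].
destruct Hf as [f' [Hd Hf']].
exists (fun x => s * f' (s * x + b)); split.
- intros x; apply (is_derive_comp f (fun x => s * x + b) x); [apply Hd|].
  auto_derive; [exact I | ring].
- apply Cn_mult; [apply Cn_const | apply IH, Hf'].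
Qed.

Lemma Cinf_affine f s b g :
  Cinf f -> (forall x, g x = s * x + b) -> Cinf (fun x => f (g x)).
Proof.
intros Hf Hg n; apply (Cn_ext n (fun x => f (s * x + b))).
- intros x; now rewrite Hg.
- apply Cn_affine, Hf.
Qed.

Lemma Cinf_sum_n (f : nat -> R -> R) N :
  (forall i, Cinf (f i)) -> Cinf (fun x => sum_n (fun i => f i x) N).
Proof.
intros Hf n; induction N as [|N IH].
- apply (Cn_ext n (f O)); [intros x; now rewrite sum_O | apply Hf].
- apply (Cn_ext n (fun x => sum_n (fun i => f i x) N + f (S N) x)).
  + intros x; now rewrite sum_Sn.
  + apply Cn_plus; [exact IH | apply Hf].
Qed.

(* [f = D^(-1/2)] satisfies [f' = - D' f^3 / 2], so each derivative of [D] gives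
   one more derivative of [f]. *)
Lemma Cinf_inv_sqrt D :
  (forall x, 0 < D x) -> Cinf D -> Cinf (fun x => / sqrt (D x)).
Proof.
intros HD Hs n; induction n as [|n IH]; [exact I|].
destruct (Hs (S n)) as [D' [Hd HD']].
set (f := fun x => / sqrt (D x)) in *.
exists (fun x => (- / 2 * D' x) * (f x * (f x * f x))); split.
- intros x; unfold f.
  assert (Hx := HD x); assert (Hq := sqrt_lt_R0 _ Hx).
  assert (Hi : is_derive (fun y => / sqrt y) (D x)
    (- / 2 * (/ sqrt (D x) * (/ sqrt (D x) * / sqrt (D x))))).
  { auto_derive; [split; [exact Hx | split; [lra | exact I]]|].
    field; lra. }
  replace (- / 2 * D' x * (/ sqrt (D x) * (/ sqrt (D x) * / sqrt (D x))))
    with (D' x * (- / 2 * (/ sqrt (D x) * (/ sqrt (D x) * / sqrt (D x)))))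
    by ring.
  apply (is_derive_comp (fun y => / sqrt y) D x); [exact Hi | apply Hd].
- apply Cn_mult; [apply Cn_mult; [apply Cn_const | exact HD']|].
  repeat apply Cn_mult; exact IH.
Qed.

(** * A smooth function vanishing exactly on the negative half-line and at 0 *)

Lemma exp_INR_mult n a : exp (INR n * a) = exp a ^ n.
Proof.
induction n as [|n IH]; [now rewrite Rmult_0_l, exp_0|].
rewrite S_INR, Rmult_plus_distr_r, exp_plus, IH, Rmult_1_l; simpl; ring.
Qed.

(** With [a = u / n], the bound [a <= exp a] raised to the power [n] gives the claim. *)
Lemma pow_le_exp n u : 0 < u -> u ^ n <= INR n ^ n * exp u.
Proof.
intros Hu; destruct n as [|n]; [simpl; pose proof (exp_ineq1 u); lra|].
assert (Hn : 0 < INR (S n)) by (apply lt_0_INR; lia).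
set (a := u / INR (S n)).
assert (Ha : 0 < a) by (apply Rdiv_lt_0_compat; assumption).
assert (Eu : u = INR (S n) * a) by (unfold a; field; lra).
rewrite Eu, Rpow_mult_distr, exp_INR_mult.
apply Rmult_le_compat_l; [apply pow_le; lra|].
apply pow_incr; pose proof (exp_ineq1 a); lra.
Qed.

(** [flat 0] is the classical function exp(-1/x) extended by 0. The factor x^(-k) makes the linear
    span of the family stable under differentiation. *)
Definition flat (k : nat) (x : R) : R :=
  if Rlt_dec 0 x then (/ x) ^ k * exp (- / x) else 0.

Lemma flat_pos k x : 0 < x -> 0 < flat k x.
Proof.
intros Hx; unfold flat; destruct (Rlt_dec 0 x) as [_|]; [|lra].
apply Rmult_lt_0_compat; [apply pow_lt, Rinv_0_lt_compat, Hx | apply exp_pos].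
Qed.

Lemma flat_0 k x : x <= 0 -> flat k x = 0.
Proof. intros Hx; unfold flat; destruct (Rlt_dec 0 x); [lra | reflexivity]. Qed.

(** The exponent [k + 2] in the exponential bound at 1/x leaves a spare factor x^2, which forces
    derivative 0 at the origin. *)
Lemma flat_le k x : Rabs (flat k x) <= INR (k + 2) ^ (k + 2) * x ^ 2.
Proof.
assert (HC : 0 < INR (k + 2) ^ (k + 2)) by (apply pow_lt, lt_0_INR; lia).
destruct (Rlt_le_dec 0 x) as [Hx|Hx].
- rewrite Rabs_pos_eq by (apply Rlt_le, flat_pos, Hx).
  unfold flat; destruct (Rlt_dec 0 x) as [_|]; [|lra].
  assert (Hu := Rinv_0_lt_compat _ Hx).
  assert (Hp := pow_le_exp (k + 2) _ Hu).
  rewrite pow_add in Hp at 1.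
  rewrite exp_Ropp.
  assert (He := exp_pos (/ x)).
  replace ((/ x) ^ k * / exp (/ x))
    with ((/ x) ^ k * (/ x) ^ 2 * (/ exp (/ x) * x ^ 2))
    by (field; lra).
  replace (INR (k + 2) ^ (k + 2) * x ^ 2)
    with (INR (k + 2) ^ (k + 2) * exp (/ x) * (/ exp (/ x) * x ^ 2))
    by (field; lra).
  apply Rmult_le_compat_r; [|exact Hp].
  apply Rmult_le_pos; [left; now apply Rinv_0_lt_compat | apply pow2_ge_0].
- rewrite flat_0, Rabs_R0 by exact Hx.
  apply Rmult_le_pos; [lra | apply pow2_ge_0].
Qed.

Lemma is_derive_flat k x :
  is_derive (flat k) x (flat (k + 2) x + - INR k * flat (k + 1) x).
Proof.
destruct (Rtotal_order x 0) as [Hx|[Hx|Hx]].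
- rewrite !flat_0 by lra.
  replace (0 + - INR k * 0) with 0 by ring.
  apply (is_derive_ext_loc (fun _ => 0)); [|apply (is_derive_const 0 x)].
  assert (Hl : locally x (fun t => t < 0)) by (apply open_lt; exact Hx).
  revert Hl; apply filter_imp; intros t Ht; rewrite flat_0; lra.
- subst x; rewrite !flat_0 by lra.
  replace (0 + - INR k * 0) with 0 by ring.
  apply is_derive_Reals; intros eps Heps.
  set (K := INR (k + 2) ^ (k + 2)).
  assert (HC : 0 < K) by (apply pow_lt, lt_0_INR; lia).
  (* The difference quotient at 0 is at most [K * Rabs h] in absolute value. *)
  assert (Hd : 0 < eps / K) by (apply Rdiv_lt_0_compat; assumption).
  exists (mkposreal _ Hd); simpl; intros h Hh Hlt.
  rewrite (flat_0 k 0) by lra; rewrite Rplus_0_l, !Rminus_0_r.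
  assert (Hb := flat_le k h); fold K in Hb.
  assert (Hh0 := Rabs_pos_lt h Hh).
  rewrite Rabs_div by exact Hh.
  apply Rmult_lt_reg_r with (Rabs h); [exact Hh0|].
  replace (Rabs (flat k h) / Rabs h * Rabs h) with (Rabs (flat k h))
    by (field; lra).
  rewrite <- pow2_abs in Hb.
  assert (Hlt' : Rabs h * K < eps).
  { apply (Rmult_lt_compat_r K) in Hlt; [|exact HC].
    replace (eps / K * K) with eps in Hlt by (field; lra); exact Hlt. }
  apply Rle_lt_trans with (1 := Hb).
  replace (K * Rabs h ^ 2) with ((Rabs h * K) * Rabs h) by ring.
  apply Rmult_lt_compat_r; assumption.
- apply (is_derive_ext_loc (fun y => (/ y) ^ k * exp (- / y))).
  + assert (Hl : locally x (fun t => 0 < t)) by (apply open_gt; exact Hx).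
    revert Hl; apply filter_imp; intros t Ht.
    unfold flat; destruct (Rlt_dec 0 t); [reflexivity | lra].
  + unfold flat; destruct (Rlt_dec 0 x) as [_|]; [|lra].
    auto_derive; [repeat split; lra|].
    (* Differentiating the power produces the exponent [pred k], so [k = 0] is treated apart. *)
    rewrite !pow_add; destruct k as [|k]; simpl pred.
    * simpl; field; lra.
    * rewrite <- (tech_pow_Rmult (/ x) k); simpl pow; field_simplify; try lra.
Qed.

Lemma Cinf_flat k : Cinf (flat k).
Proof.
intros n; revert k; induction n as [|n IH]; intros k; [exact I|].
exists (fun x => flat (k + 2) x + - INR k * flat (k + 1) x); split.
- apply is_derive_flat.
- apply Cn_plus; [apply IH|].
  apply (Cn_mult n (fun _ => _) (flat (k + 1))); [apply Cn_const | apply IH].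
Qed.

(** * Real sums over the window from -M to M *)

Definition wsum (M : nat) (G : Z -> R) : R :=
  sum_n (fun i : nat => G (Z.of_nat i - Z.of_nat M)%Z) (2 * M).

Lemma wsum_ext M F G : (forall i, F i = G i) -> wsum M F = wsum M G.
Proof. intros H; apply sum_n_ext; intros n; apply H. Qed.

Lemma wsum_mult_l M c G : wsum M (fun i => c * G i) = c * wsum M G.
Proof.
apply (sum_n_mult_l c (fun i : nat => G (Z.of_nat i - Z.of_nat M)%Z)).
Qed.

Lemma wsum_nonneg M G : (forall i, 0 <= G i) -> 0 <= wsum M G.
Proof.
intros HG; unfold wsum; induction (2 * M)%nat as [|N IH].
- rewrite sum_O; apply HG.
- rewrite sum_Sn; apply Rplus_le_le_0_compat; [exact IH | apply HG].
Qed.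

Lemma wsum_ge_term M G j :
  (forall i, 0 <= G i) -> (- Z.of_nat M <= j <= Z.of_nat M)%Z ->
  G j <= wsum M G.
Proof.
intros HG Hj; unfold wsum.
assert (H : forall N, (Z.to_nat (j + Z.of_nat M) <= N)%nat ->
  G j <= sum_n (fun i : nat => G (Z.of_nat i - Z.of_nat M)%Z) N).
{ assert (Hnn : forall N,
    0 <= sum_n (fun i : nat => G (Z.of_nat i - Z.of_nat M)%Z) N).
  { induction N as [|N IH]; [rewrite sum_O; apply HG|].
    rewrite sum_Sn; apply Rplus_le_le_0_compat; [exact IH | apply HG]. }
  induction N as [|N IH]; intros HN.
  - rewrite sum_O.
    replace (Z.of_nat 0 - Z.of_nat M)%Z with j by lia; apply Rle_refl.
  - rewrite sum_Sn; change plus with Rplus.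
    destruct (Nat.eq_dec (Z.to_nat (j + Z.of_nat M)) (S N)) as [E|E].
    + replace (Z.of_nat (S N) - Z.of_nat M)%Z with j by lia.
      specialize (Hnn N); lra.
    + specialize (IH ltac:(lia)).
      specialize (HG (Z.of_nat (S N) - Z.of_nat M)%Z); lra. }
apply H; lia.
Qed.

(** Both sides are the sum of [G] from -M to M + 1. *)
Lemma wsum_succ M G :
  wsum M (fun i => G (i + 1)%Z) + G (- Z.of_nat M)%Z
  = wsum M G + G (Z.of_nat M + 1)%Z.
Proof.
unfold wsum.
replace (Z.of_nat M + 1)%Z with (Z.of_nat (2 * M) + 1 - Z.of_nat M)%Z by lia.
induction (2 * M)%nat as [|N IH].
- rewrite !sum_O, Rplus_comm.
  replace (Z.of_nat 0 - Z.of_nat M + 1)%Z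
    with (Z.of_nat 0 + 1 - Z.of_nat M)%Z by lia.
  now replace (Z.of_nat 0 - Z.of_nat M)%Z with (- Z.of_nat M)%Z by lia.
- rewrite !sum_Sn; change plus with Rplus.
  replace (Z.of_nat (S N) - Z.of_nat M)%Z
    with (Z.of_nat N + 1 - Z.of_nat M)%Z by lia.
  replace (Z.of_nat N + 1 - Z.of_nat M + 1)%Z
    with (Z.of_nat (S N) + 1 - Z.of_nat M)%Z by lia.
  lra.
Qed.

(** Each unit shift exchanges one end term for another, and both lie outside the support allowed to
    [G]. *)
Lemma wsum_shift_nat M G n :
  (forall i, G i <> 0 -> (Z.of_nat n - Z.of_nat M <= i <= Z.of_nat M)%Z) ->
  wsum M (fun i => G (i + Z.of_nat n)%Z) = wsum M G.
Proof.
induction n as [|n IH]; intros HG.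
- apply wsum_ext; intros i; f_equal; lia.
- rewrite <- IH by (intros i Hi; specialize (HG i Hi); lia).
  assert (H := wsum_succ M (fun i => G (i + Z.of_nat n)%Z)); cbv beta in H.
  assert (H1 : G (- Z.of_nat M + Z.of_nat n)%Z = 0).
  { destruct (Req_dec (G (- Z.of_nat M + Z.of_nat n)%Z) 0) as [E|E];
      [exact E | specialize (HG _ E); lia]. }
  assert (H2 : G (Z.of_nat M + 1 + Z.of_nat n)%Z = 0).
  { destruct (Req_dec (G (Z.of_nat M + 1 + Z.of_nat n)%Z) 0) as [E|E];
      [exact E | specialize (HG _ E); lia]. }
  rewrite H1, H2, !Rplus_0_r in H; rewrite <- H.
  apply wsum_ext; intros i; f_equal; lia.
Qed.

Lemma wsum_shift M G a :
  (forall i, G i <> 0 -> (- Z.of_nat M <= i <= Z.of_nat M)%Z /\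
     (a - Z.of_nat M <= i <= a + Z.of_nat M)%Z) ->
  wsum M (fun i => G (i + a)%Z) = wsum M G.
Proof.
intros HG; destruct (Z_le_gt_dec 0 a) as [Ha|Ha].
- rewrite <- (wsum_shift_nat M G (Z.to_nat a)).
  + apply wsum_ext; intros i; f_equal; lia.
  + intros i Hi; specialize (HG i Hi); lia.
(* For negative [a], the natural shift by [- a] is applied to the already shifted summand and leads
   back to [G]. *)
- rewrite <- (wsum_shift_nat M (fun i => G (i + a)%Z) (Z.to_nat (- a))).
  + apply wsum_ext; intros i; f_equal; lia.
  + intros i Hi; specialize (HG _ Hi); lia.
Qed.

Definition deltaR (i j : Z) : R := if Z.eq_dec i j then 1 else 0.

(** If [k - a] falls outside the window, no term survives; the hypothesis then makes the right side
    0 as well. *)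
Lemma wsum_deltaR M c a k :
  (~ (- Z.of_nat M <= k - a <= Z.of_nat M)%Z -> c (k - a)%Z = 0) ->
  wsum M (fun m => c m * deltaR (m + a) k) = c (k - a)%Z.
Proof.
intros Hc; unfold wsum.
(* For the partial sums, the two tests record whether the index [k - a] has been reached. *)
assert (H : forall N,
  sum_n (fun i : nat => c (Z.of_nat i - Z.of_nat M)%Z
           * deltaR (Z.of_nat i - Z.of_nat M + a) k) N
  = if Z_le_dec 0 (k - a + Z.of_nat M)
    then if Z_le_dec (k - a + Z.of_nat M) (Z.of_nat N)
         then c (k - a)%Z else 0
    else 0).
{ induction N as [|N IH]; [rewrite sum_O | rewrite sum_Sn, IH];
    unfold deltaR; change plus with Rplus;
    match goal with |- ?u = ?v => change (@eq R u v) end;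
    repeat match goal with |- context [if ?b then _ else _] => destruct b end;
    try lia; try ring.
  - replace (Z.of_nat 0 - Z.of_nat M)%Z with (k - a)%Z by lia; ring.
  - replace (Z.of_nat (S N) - Z.of_nat M)%Z with (k - a)%Z by lia; ring. }
rewrite H.
destruct (Z_le_dec 0 (k - a + Z.of_nat M)) as [H1|H1];
  [destruct (Z_le_dec (k - a + Z.of_nat M) (Z.of_nat (2 * M))) as [H2|H2]|].
- reflexivity.
- symmetry; apply Hc; lia.
- symmetry; apply Hc; lia.
Qed.

Lemma sum_sym_RtoC M F G :
  (forall i, F i = RtoC (G i)) -> sum_sym M F = RtoC (wsum M G).
Proof.
intros H; unfold sum_sym, wsum.
induction (2 * M)%nat as [|N IH]; [rewrite !sum_O; apply H|].
rewrite !sum_Sn, IH, H; symmetry; apply RtoC_plus.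
Qed.

(** * The normalised profile on the interval (0, L) *)

(** Two points of (0, L) are less than (M + 1) theta apart, so [j] is less than M + 1 in absolute
    value. Thus the window sees every translate inside the interval. *)
Lemma translates_band theta L M x j :
  0 < theta -> L <= INR (S M) * theta -> 0 < x < L ->
  0 < x + IZR j * theta < L -> (- Z.of_nat M <= j <= Z.of_nat M)%Z.
Proof.
intros Hth HL Hx Hj; rewrite INR_IZR_INZ in HL.
assert (H1 : (j < Z.of_nat (S M))%Z).
{ apply lt_IZR, Rmult_lt_reg_r with theta; lra. }
assert (H2 : (- j < Z.of_nat (S M))%Z).
{ apply lt_IZR, Rmult_lt_reg_r with theta; rewrite ?opp_IZR; lra. }
lia.
Qed.

(** A bump [beta] is divided by the square root of [S0], the sum of its squares along the orbit.
    This normalises it because [S0] agrees at any two points of (0, L) on one orbit. *)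
Lemma exists_profile theta L M :
  (1 <= M)%nat -> 0 < theta < L -> L <= INR (S M) * theta ->
  exists phi : R -> R, Cinf phi /\
    (forall x, 0 < x < L -> 0 < phi x) /\
    (forall x, phi x <> 0 -> 0 < x < L) /\
    (forall x, 0 < x < L ->
       wsum M (fun a => phi (x + IZR a * theta) ^ 2) = 1).
Proof.
intros HM Hth HL.
set (beta := fun x => flat 0 x * flat 0 (L - x)).
assert (Hb : forall x, 0 < x < L -> 0 < beta x).
{ intros x Hx; apply Rmult_lt_0_compat; apply flat_pos; lra. }
assert (Hb0 : forall x, beta x <> 0 -> 0 < x < L).
{ intros x Hx; unfold beta in Hx; split; apply Rnot_le_lt; intros Hle; apply Hx.
  - rewrite (flat_0 0 x) by lra; ring.
  - rewrite (flat_0 0 (L - x)) by lra; ring. }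
assert (Sb : Cinf beta).
{ intros n; apply Cn_mult; [apply Cinf_flat|].
  apply (Cinf_affine (flat 0) (-1) L (fun x => L - x)); [apply Cinf_flat|].
  intros x; ring. }
set (S0 := fun x => wsum M (fun a => beta (x + IZR a * theta) ^ 2)).
(* The flat terms vanish on [0, L]; they only make [D] positive everywhere. *)
set (D := fun x => S0 x + (flat 0 (- x) + flat 0 (x - L))).
assert (Hge : forall x j, (- Z.of_nat M <= j <= Z.of_nat M)%Z ->
  beta (x + IZR j * theta) ^ 2 <= S0 x).
{ intros x j Hj.
  apply (wsum_ge_term M (fun a => beta (x + IZR a * theta) ^ 2));
    [intros i; apply pow2_ge_0 | exact Hj]. }
assert (Hfl : forall x, 0 <= flat 0 x).
{ intros x; destruct (Rlt_le_dec 0 x) as [Hx|Hx];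
    [left; now apply flat_pos | right; now rewrite flat_0]. }
assert (HD : forall x, 0 < D x).
{ intros x; unfold D.
  assert (F1 := Hfl (- x)); assert (F2 := Hfl (x - L)).
  assert (HS : 0 <= S0 x) by (apply wsum_nonneg; intros i; apply pow2_ge_0).
  assert (HSj : forall j, (- Z.of_nat M <= j <= Z.of_nat M)%Z ->
    0 < x + IZR j * theta < L -> 0 < S0 x).
  { intros j Hj Hxj; apply Rlt_le_trans with (2 := Hge x j Hj).
    apply pow_lt, Hb, Hxj. }
  (* Outside [0, L] a flat term is positive. At 0 and at L the translate by [theta], respectively
     [- theta], lies in (0, L) because [theta < L]; inside, the point itself serves. *)
  destruct (Rtotal_order x 0) as [Hx|[Hx|Hx]].
  - assert (F := flat_pos 0 (- x)); lra.
  - assert (F := HSj 1%Z ltac:(lia) ltac:(simpl; lra)); lra.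
  - destruct (Rtotal_order x L) as [Hy|[Hy|Hy]].
    + assert (F := HSj 0%Z ltac:(lia) ltac:(simpl; lra)); lra.
    + assert (F := HSj (-1)%Z ltac:(lia) ltac:(simpl; lra)); lra.
    + assert (F := flat_pos 0 (x - L)); lra. }
assert (SD : Cinf D).
{ intros n; apply Cn_plus; [|apply Cn_plus].
  - unfold S0, wsum.
    apply (Cinf_sum_n
      (fun i x => beta (x + IZR (Z.of_nat i - Z.of_nat M) * theta) ^ 2)).
    intros i m.
    assert (Hi : Cn m
      (fun x => beta (x + IZR (Z.of_nat i - Z.of_nat M) * theta))).
    { apply (Cinf_affine beta 1 (IZR (Z.of_nat i - Z.of_nat M) * theta)
        (fun x => x + IZR (Z.of_nat i - Z.of_nat M) * theta)); [exact Sb|].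
      intros x; ring. }
    apply (Cn_mult m _ _ Hi), (Cn_mult m _ _ Hi), Cn_const.
  - apply (Cinf_affine (flat 0) (-1) 0 (fun x => - x)); [apply Cinf_flat|].
    intros x; ring.
  - apply (Cinf_affine (flat 0) 1 (- L) (fun x => x - L)); [apply Cinf_flat|].
    intros x; ring. }
exists (fun x => beta x * / sqrt (D x)); split; [|split; [|split]].
- intros n; apply Cn_mult; [apply Sb | now apply Cinf_inv_sqrt].
- intros x Hx; apply Rmult_lt_0_compat; [now apply Hb|].
  apply Rinv_0_lt_compat, sqrt_lt_R0, HD.
- intros x Hx; apply Hb0; intros E; apply Hx; rewrite E; ring.
- intros x Hx.
  assert (ED : forall y, 0 < y < L -> D y = S0 y).
  { intros y Hy; unfold D; rewrite !flat_0 by lra; ring. }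
  (* Windows centred at either point contain all the nonzero terms, so recentring the sum loses
     nothing. *)
  assert (EI : forall a, 0 < x + IZR a * theta < L ->
    S0 (x + IZR a * theta) = S0 x).
  { intros a Ha; unfold S0.
    rewrite <- (wsum_shift M (fun i => beta (x + IZR i * theta) ^ 2) a).
    - apply wsum_ext; intros i; rewrite plus_IZR; do 2 f_equal; ring.
    - intros i Hi.
      assert (Hi' : 0 < x + IZR i * theta < L).
      { apply Hb0; intros E; apply Hi; rewrite E; ring. }
      split; [now apply (translates_band theta L M x); try lra|].
      assert (H := translates_band theta L M (x + IZR a * theta) (i - a)).
      rewrite minus_IZR in H.
      enough (- Z.of_nat M <= i - a <= Z.of_nat M)%Z by lia.
      apply H; try lra. }
  assert (HS : 0 < S0 x) by (rewrite <- ED by exact Hx; apply HD).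
  transitivity (wsum M (fun a => / S0 x * beta (x + IZR a * theta) ^ 2)).
  + apply wsum_ext; intros a.
    destruct (Req_dec (beta (x + IZR a * theta)) 0) as [E|E];
      [rewrite E; ring|].
    assert (Ha := Hb0 _ E).
    rewrite Rpow_mult_distr, pow_inv, pow2_sqrt by (apply Rlt_le, HD).
    rewrite ED, EI by exact Ha; apply Rmult_comm.
  + rewrite wsum_mult_l; fold (S0 x); apply Rinv_l; lra.
Qed.

(** * Periodic extension through the fractional part *)

Lemma frac_part_unique x y n : 0 <= y < 1 -> x = IZR n + y -> frac_part x = y.
Proof.
intros Hy E; symmetry; exact (proj2 (Int_part_frac_part_spec x n y Hy E)).
Qed.

Lemma frac_part_shift x s :
  0 <= frac_part x + s < 1 -> frac_part (x + s) = frac_part x + s.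
Proof.
intros H; apply (frac_part_unique _ _ (Int_part x) H).
rewrite (Rplus_Int_part_frac_part x) at 1; ring.
Qed.

(** The jumps of [frac_part] are harmless: on (N - 1, N + 1) the function is the sum of two
    translates of [g], of which at most one is nonzero at each point. *)
Lemma Cinf_frac_part g :
  Cinf g -> (forall x, g x <> 0 -> 0 < x < 1) ->
  forall n x, ex_derive_n (fun t => g (frac_part t)) n x.
Proof.
intros Sg Hg n x; set (N := IZR (Int_part x)).
assert (Hg0 : forall y, ~ 0 < y < 1 -> g y = 0).
{ intros y Hy; destruct (Req_dec (g y) 0) as [E|E];
    [exact E | now specialize (Hg y E)]. }
assert (Hx := base_fp x); assert (Ex := Rplus_Int_part_frac_part x).
fold N in Ex.
apply (ex_derive_n_ext_loc (fun t => g (t - N) + g (t - N + 1))).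
- assert (Hl : locally x (fun t => N - 1 < t < N + 1)).
  { apply filter_and; [apply open_gt | apply open_lt]; lra. }
  revert Hl; apply filter_imp; intros t Ht.
  destruct (Rle_lt_dec N t) as [HN|HN].
  + rewrite (frac_part_unique t (t - N) (Int_part x)) by (fold N; lra).
    rewrite (Hg0 (t - N + 1)) by lra; ring.
  + rewrite (frac_part_unique t (t - N + 1) (Int_part x - 1))
      by (rewrite ?minus_IZR; fold N; lra).
    rewrite (Hg0 (t - N)) by lra; ring.
- apply Cn_ex_derive_n, Cn_plus.
  + apply (Cinf_affine g 1 (- N) (fun t => t - N)); [exact Sg|].
    intros t; ring.
  + apply (Cinf_affine g 1 (1 - N) (fun t => t - N + 1)); [exact Sg|].
    intros t; ring.
Qed.

(** * The coefficients [p] and the projection equations *)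

Theorem theorem2 (theta : R) (M : nat)
  (htheta : 0 <= theta < 1) (hirr : irrational theta)
  (hM : (1 <= M)%nat) (hthetaM : 0 < theta < 1 / INR M) :
  exists p : Z -> R -> C,
    (forall k : Z, (- Z.of_nat M <= k <= Z.of_nat M)%Z ->
       smooth_periodic (p k)) /\
    (forall k : Z, (0 <= k <= Z.of_nat M)%Z ->
       exists x : R, p k x <> RtoC 0) /\
    (forall (k : Z) (x : R), (- Z.of_nat M <= k <= Z.of_nat M)%Z ->
       p k x = Cconj (p (- k)%Z (x + IZR k * theta))) /\
    (forall (k : Z) (x : R), (- Z.of_nat M <= k <= Z.of_nat M)%Z ->
       p k x = square_coef theta M p k x) /\
    (forall (k : Z) (x : R),
       (k < - Z.of_nat M \/ k > Z.of_nat M)%Z ->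
       RtoC 0 = square_coef theta M p k x).
Proof.
assert (HMpos : 0 < INR M) by (apply lt_0_INR; lia).
assert (HM1 : INR M * theta < 1).
{ apply Rmult_lt_reg_r with (/ INR M); [now apply Rinv_0_lt_compat|].
  replace (INR M * theta * / INR M) with theta by (field; lra); lra. }
assert (HMth : theta <= INR M * theta).
{ assert (H : 1 <= INR M) by (apply (le_INR 1); exact hM).
  apply (Rmult_le_compat_r theta) in H; lra. }
(* The largest length allowed by both upper bounds; each bound exceeds M theta. *)
set (L := Rmin 1 (INR (S M) * theta)).
assert (HL1 : L <= 1) by apply Rmin_l.
assert (HLM : L <= INR (S M) * theta) by apply Rmin_r.
assert (HML : INR M * theta < L).
{ apply Rmin_glb_lt; [exact HM1 | rewrite S_INR; lra]. }
destruct (exists_profile theta L M hM) as [phi [Sphi [Hpos [Hsupp Hsum]]]];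
  [lra | exact HLM |].
assert (Hdec : forall x, phi x = 0 \/ 0 < x < L).
{ intros x; destruct (Req_dec (phi x) 0); auto. }
set (q := fun k x => phi (x + IZR k * theta) * phi x).
assert (Hq : forall k x, q k x <> 0 ->
  0 < x < L /\ 0 < x + IZR k * theta < L).
{ intros k x H; unfold q in H; split; apply Hsupp; intros E; apply H;
    rewrite E; ring. }
assert (Hq0 : forall k x, ~ (- Z.of_nat M <= k <= Z.of_nat M)%Z -> q k x = 0).
{ intros k x Hk; destruct (Req_dec (q k x) 0) as [E|E]; [exact E|].
  destruct (Hq k x E) as [H1 H2]; exfalso; apply Hk.
  now apply (translates_band theta L M x). }
set (p := fun k x => RtoC (q k (frac_part x))).
(* Stated for every integer [k]: since [p k] vanishes outside the window, it yields both families of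
   quadratic equations. *)
assert (Hsq : forall k x, square_coef theta M p k x = p k x).
{ intros k x; set (t := frac_part x).
  set (c := fun a m =>
    phi (t + IZR (m + a) * theta) * phi t * phi (t + IZR a * theta) ^ 2).
  assert (Hterm : forall m a,
    Cmult (Cmult (p m (x + IZR a * theta)) (p a x)) (delta (m + a) k)
    = RtoC (c a m * deltaR (m + a) k)).
  { intros m a.
    replace (delta (m + a) k) with (RtoC (deltaR (m + a) k))
      by (unfold delta, deltaR; destruct (Z.eq_dec (m + a) k); reflexivity).
    unfold p; rewrite <- !RtoC_mult; f_equal; f_equal.
    unfold c, q; fold t.
    (* Either both sides contain a zero factor, or [t + IZR a * theta] lies in (0, 1) and is the
       fractional part of [x + IZR a * theta]. *)
    destruct (Hdec (t + IZR a * theta)) as [E|E]; [rewrite E; ring|].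
    rewrite frac_part_shift by (fold t; lra); fold t.
    replace (t + IZR (m + a) * theta)
      with (t + IZR a * theta + IZR m * theta) by (rewrite plus_IZR; ring).
    ring. }
  unfold square_coef.
  rewrite (sum_sym_RtoC M _
    (fun m => wsum M (fun a => c a m * deltaR (m + a) k)))
    by (intros m; apply sum_sym_RtoC; intros a; apply Hterm).
  unfold p; fold t; f_equal.
  (* With the sum over [m] innermost, the Kronecker symbol selects [m = k - a]. *)
  transitivity (wsum M (fun a => wsum M (fun m => c a m * deltaR (m + a) k))).
  { unfold wsum; apply (sum_n_switch (fun i j : nat =>
      c (Z.of_nat j - Z.of_nat M)%Z (Z.of_nat i - Z.of_nat M)%Z
      * deltaR (Z.of_nat i - Z.of_nat M + (Z.of_nat j - Z.of_nat M)) k)). }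
  transitivity (wsum M (fun a => q k t * phi (t + IZR a * theta) ^ 2)).
  { apply wsum_ext; intros a; rewrite wsum_deltaR.
    - unfold c, q; replace (k - a + a)%Z with k by lia; reflexivity.
    - intros Hka; unfold c; replace (k - a + a)%Z with k by lia.
      destruct (Hdec (t + IZR a * theta)) as [E|E]; [rewrite E; ring|].
      (* The points [t + IZR k * theta] and [t + IZR a * theta] are too far apart for [phi] to be
         nonzero at both. *)
      assert (F := Hq0 (k - a)%Z (t + IZR a * theta) Hka); unfold q in F.
      replace (t + IZR a * theta + IZR (k - a) * theta)
        with (t + IZR k * theta) in F by (rewrite minus_IZR; ring).
      replace (phi (t + IZR k * theta) * phi t * phi (t + IZR a * theta) ^ 2)
        with (phi (t + IZR k * theta) * phi (t + IZR a * theta)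
              * (phi t * phi (t + IZR a * theta))) by ring.
      rewrite F; ring. }
  (* A nonzero [q k t] places [t] in (0, L), where the squares sum to 1. *)
  rewrite wsum_mult_l; destruct (Req_dec (q k t) 0) as [E|E];
    [rewrite E; ring|].
  rewrite Hsum by apply (Hq k t E); ring. }
exists p; split; [|split; [|split; [|split]]].
- intros k _; split.
  + intros n x; split; [|exact (Cn_ex_derive_n n _ (Cn_const n 0) x)].
    apply (Cinf_frac_part (q k)).
    * intros m; apply Cn_mult; [|apply Sphi].
      apply (Cinf_affine phi 1 (IZR k * theta)
        (fun y => y + IZR k * theta)); [exact Sphi|].
      intros y; ring.
    * intros y Hy; destruct (Hq k y Hy) as [H _]; lra.
  + intros x; unfold p; do 2 f_equal.
    apply (frac_part_unique _ _ (Int_part x + 1)%Z).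
    * assert (H := base_fp x); lra.
    * rewrite plus_IZR, (Rplus_Int_part_frac_part x) at 1; ring.
- intros k Hk.
  assert (Hk0 : 0 <= IZR k * theta <= INR M * theta).
  { rewrite INR_IZR_INZ; destruct Hk as [Hk1 Hk2].
    apply IZR_le in Hk1; apply IZR_le in Hk2.
    split; [apply Rmult_le_pos; lra | apply Rmult_le_compat_r; lra]. }
  (* This choice puts [x] and [x + IZR k * theta] symmetrically about L / 2, both inside (0, L). *)
  set (x := (L - IZR k * theta) / 2); exists x.
  assert (Hx : frac_part x = x).
  { apply (frac_part_unique _ _ 0%Z); [unfold x; lra | simpl; ring]. }
  unfold p; rewrite Hx; intros E; apply RtoC_inj in E.
  assert (F : 0 < q k x).
  { apply Rmult_lt_0_compat; apply Hpos; unfold x; lra. }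
  lra.
- intros k x _; unfold p.
  replace (Cconj (RtoC (q (- k)%Z (frac_part (x + IZR k * theta)))))
    with (RtoC (q (- k)%Z (frac_part (x + IZR k * theta))))
    by (unfold Cconj; simpl; now rewrite Ropp_0).
  f_equal.
  (* On representatives the identity is the symmetry of the product defining [q]. If either side is
     nonzero, its two points lie in (0, L), so the shift commutes with [frac_part]. *)
  destruct (Req_dec (q k (frac_part x)) 0) as [E|E].
  + destruct (Req_dec (q (- k)%Z (frac_part (x + IZR k * theta))) 0)
      as [E'|E']; [now rewrite E, E'|].
    destruct (Hq _ _ E') as [H1 H2]; rewrite opp_IZR in H2.
    assert (Hf := frac_part_shift (x + IZR k * theta) (- IZR k * theta)
      ltac:(lra)).
    replace (x + IZR k * theta + - IZR k * theta) with x in Hf by ring.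
    exfalso; apply E'; rewrite <- E, Hf; unfold q; rewrite opp_IZR.
    rewrite Rmult_comm; f_equal; f_equal; ring.
  + destruct (Hq _ _ E) as [H1 H2].
    rewrite frac_part_shift by lra; unfold q; rewrite opp_IZR.
    rewrite Rmult_comm; f_equal; f_equal; ring.
- intros k x _; symmetry; apply Hsq.
- intros k x Hk; rewrite Hsq; unfold p; rewrite Hq0; [reflexivity | lia].
Qed.
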